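(* Let $K>1$ be an integer, $N=2K+1$, $Z\in(0,\infty)$ and $\sigma\in\{+1,-1\}$. Define the sequence $(f_k(Z))_{k\in\mathbb{Z}}$ by $f_0(Z)=1$, $f_1(Z)=1+Z$ and $f_{k+2}(Z)=(2+Z)f_{k+1}(Z)-f_k(Z)$ for all $k\in\mathbb{Z}$, and set $\lambda_k(Z)=f_{K-k}(Z)$. Let $$d(Z)=\sum_{k=0}^N\binom{N}{k}\lambda_k(Z)\ket{D_N^k}\bra{D_N^k},\qquad o(\sigma)=\sigma\left(\ket{D_N^0}\bra{D_N^N}+\ket{D_N^N}\bra{D_N^0}\right),$$ and $\rho(Z)=\dfrac{d(Z)+o(\sigma)}{2(4+Z)^K}$. Then the $N$-qubit symmetric state $\rho(Z)$ is PPT with respect to every bipartition; the ranks of $\rho(Z),\rho(Z)^{\Gamma_1},\dots,\rho(Z)^{\Gamma_K}$ are $N+1,2N,\dots,2N,2N-1$ respectively; and $\rho(Z)$ is an extreme point of the set of $N$-qubit states that are PPT with respect to every bipartition (in particular, $\rho(Z)$ is entangled, i.e. not fully separable).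
   Context: For $N$ qubits with computational basis $\{\ket0,\ket1\}$, the Dicke state $\ket{D_N^k}$ ($0\le k\le N$) is the normalized equal superposition of all computational basis vectors of $(\mathbb{C}^2)^{\otimes N}$ with exactly $k$ qubits in $\ket1$. For $0\le m\le N$, $\rho^{\Gamma_m}$ denotes the partial transpose (in the computational basis) of $\rho$ with respect to a set of $m$ of the qubits (for a permutation-symmetric state this does not depend on which $m$ qubits). A state is PPT with respect to every bipartition if its partial transpose with respect to every subset of qubits is positive semidefinite. A state is fully separable if it is a convex combination of product states $\rho^{(1)}\otimes\cdots\otimes\rho^{(N)}$; it is entangled otherwise. *)

(* Defs.v *)
From HB Require Import structures.
From mathcomp Require Import all_boot all_order all_algebra.
From mathcomp Require Import reals.
From mathcomp.real_closed Require Import complex.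

Set Implicit Arguments.
Unset Strict Implicit.
Unset Printing Implicit Defensive.

Import Order.TTheory GRing.Theory Num.Theory.
Local Open Scope ring_scope.
Local Open Scope complex_scope.

Section QubitDefs.
Variable R : realType.
Local Notation C := R[i].

(* Computational basis of (C^2)^{\otimes N}: the basis vector with index
   i < 2^N has qubit k (k < N) in state |1> iff bit k of i is 1. *)
Definition qbit (N : nat) (i : nat) (k : 'I_N) : bool := odd (i %/ 2 ^ k).

Definition of_bits (N : nat) (b : 'I_N -> bool) : nat :=
  (\sum_(k < N) (b k : nat) * 2 ^ k)%N.

Definition hweight (N : nat) (i : nat) : nat := (\sum_(k < N) qbit i k)%N.

Definition adjmx m n (A : 'M[C]_(m, n)) : 'M[C]_(n, m) := map_mx Num.conj A^T.

Definition dicke (N k : nat) : 'cV[C]_(2 ^ N) :=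
  \col_(i < 2 ^ N)
    (if hweight N i == k then ((Num.sqrt ('C(N, k)%:R : R))^-1)%:C else 0).

Definition ketbra n (u v : 'cV[C]_n) : 'M[C]_n := u *m adjmx v.

(* Partial transpose (in the computational basis) with respect to the set
   S of qubits:  <x_S x_S'| A^{Gamma_S} |y_S y_S'> = <y_S x_S'| A |x_S y_S'>. *)
Definition ptrans (N : nat) (S : {set 'I_N}) (A : 'M[C]_(2 ^ N)) : 'M[C]_(2 ^ N) :=
  \matrix_(i, j)
    A (insubd i (of_bits (fun k => if k \in S then qbit j k else qbit i k)))
      (insubd j (of_bits (fun k => if k \in S then qbit i k else qbit j k))).

Definition psd n (A : 'M[C]_n) : Prop :=
  adjmx A = A /\ forall v : 'cV[C]_n, 0 <= (adjmx v *m A *m v) 0 0.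

Definition is_state n (A : 'M[C]_n) : Prop := psd A /\ \tr A = 1.

Definition ppt_all (N : nat) (A : 'M[C]_(2 ^ N)) : Prop :=
  is_state A /\ forall S : {set 'I_N}, psd (ptrans S A).

Definition extreme_point n (P : 'M[C]_n -> Prop) (A : 'M[C]_n) : Prop :=
  P A /\ forall (A1 A2 : 'M[C]_n) (t : R), P A1 -> P A2 -> 0 < t < 1 ->
    A = (t%:C) *: A1 + ((1 - t)%:C) *: A2 -> A1 = A /\ A2 = A.

Definition qbit2 (N : nat) (i : nat) (k : 'I_N) : 'I_2 := inord (qbit i k).

Definition prod_op (N : nat) (M : 'I_N -> 'M[C]_2) : 'M[C]_(2 ^ N) :=
  \matrix_(i, j) \prod_(k < N) M k (qbit2 i k) (qbit2 j k).

Definition fully_separable (N : nat) (A : 'M[C]_(2 ^ N)) : Prop :=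
  exists (m : nat) (p : 'I_m -> R) (M : 'I_m -> 'I_N -> 'M[C]_2),
    [/\ forall l, 0 <= p l,
        \sum_(l < m) p l = 1,
        forall l k, is_state (M l k) &
        A = \sum_(l < m) (p l)%:C *: prod_op (M l)].

End QubitDefs.

(* Main.v *)
(* Index the computational basis by sets [x] of qubits.  The entry of the partial
   transpose rho^{Gamma_S} at [(x, y)] vanishes unless the Hamming distances
   [#|x (+) S|] and [#|y (+) S|] agree, apart from one pair of entries [sigma]
   linking [x = S] to [x = ~: S].  Writing [lambda_k = A s^(2k) + B u^(2k)] with
   [s u = 1] and [s + u = sqrt (4 + Z)], each distance class is a Gram matrix of the
   two independent vectors [s^|x|] and [u^|x|], and the linked pair is a 2x2 block
   that is singular exactly when [lambda_|S| = 1]; positivity and the ranks follow.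

   If [rho = X + Y] with both terms PPT, then every kernel vector of every partial
   transpose of [rho] is one of [X].  For [S] empty this makes [X] symmetric, with
   entries [g (|x|) (|y|)].  For [|S| = K] it gives the three-term recurrence of
   [lambda] along every diagonal of [g], together with
   [g (K + j) i = sigma g j (i + K + 1)].  Hermiticity and these relations
   force three equal consecutive entries on each off-diagonal, which the recurrence
   (where [Z <> 0]) only allows if they vanish; hence [X] is a multiple of [rho].
   A fully separable decomposition would then make [rho] proportional to a product
   operator, which its zero pattern forbids. *)

Require Import Defs.
From HB Require Import structures.
From mathcomp Require Import all_boot all_order all_algebra.
From mathcomp Require Import reals.
From mathcomp.real_closed Require Import complex.
From mathcomp Require Import zify ring lra.

Set Implicit Arguments.
Unset Strict Implicit.
Unset Printing Implicit Defensive.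

Import Order.TTheory GRing.Theory Num.Theory.
Local Open Scope ring_scope.

(** * Basis states as sets of qubits *)

Lemma of_bitsS N (b : 'I_N.+1 -> bool) :
  of_bits b = (b ord0 + (of_bits (fun k => b (lift ord0 k))).*2)%N.
Proof.
rewrite /of_bits big_ord_recl expn0 muln1 -mul2n big_distrr /=; congr addn.
by apply: eq_bigr => k _; rewrite /= /bump /= add1n expnS mulnCA.
Qed.

Lemma of_bits_lt N (b : 'I_N -> bool) : (of_bits b < 2 ^ N)%N.
Proof.
elim: N b => [|N IH] b; first by rewrite /of_bits big_ord0.
by rewrite of_bitsS expnS; have := IH (fun k => b (lift ord0 k)); case: (b ord0) => /=; lia.
Qed.

Lemma qbit0 N i : qbit i (@ord0 N) = odd i.
Proof. by rewrite /qbit expn0 divn1. Qed.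

Lemma qbitS N i (k : 'I_N) : qbit i (lift ord0 k) = qbit i./2 k.
Proof. by rewrite /qbit /= /bump /= add1n expnS divnMA divn2. Qed.

Lemma eq_of_bits N (b c : 'I_N -> bool) : b =1 c -> of_bits b = of_bits c.
Proof. by move=> e; apply: eq_bigr => k _; rewrite e. Qed.

Lemma of_bitsK N (b : 'I_N -> bool) (k : 'I_N) : qbit (of_bits b) k = b k.
Proof.
elim: N b k => [|N IH] b k; first by case: k.
rewrite of_bitsS; case: (unliftP ord0 k) => [j|] ->.
  by rewrite qbitS half_bit_double IH.
by rewrite qbit0 oddD odd_double addbF; case: (b _).
Qed.

Lemma qbitK N i : (i < 2 ^ N)%N -> of_bits (fun k : 'I_N => qbit i k) = i.
Proof.
elim: N i => [|N IH] i; first by rewrite /of_bits big_ord0; case: i.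
rewrite expnS => lti; rewrite of_bitsS qbit0.
rewrite (eq_of_bits (c := fun k => qbit i./2 k)); last by move=> k; rewrite qbitS.
by rewrite IH ?odd_double_half//; have := odd_double_half i; lia.
Qed.

Definition ones {N} (i : 'I_(2 ^ N)) : {set 'I_N} := [set k | qbit i k].

Definition of_set {N} (x : {set 'I_N}) : 'I_(2 ^ N) :=
  Ordinal (of_bits_lt (fun k => k \in x)).

Lemma onesK N : cancel (@ones N) of_set.
Proof.
move=> i; apply/val_inj => /=; rewrite -[RHS](@qbitK N)//.
by apply: eq_of_bits => k; rewrite inE.
Qed.

Lemma of_setK N : cancel (@of_set N) ones.
Proof. by move=> x; apply/setP => k; rewrite inE of_bitsK. Qed.

Lemma hweightE N (i : 'I_(2 ^ N)) : hweight N i = #|ones i|.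
Proof.
rewrite /hweight -sum1_card [RHS]big_mkcond /=.
by apply: eq_bigr => k _; rewrite inE; case: qbit.
Qed.

Lemma big_ones (V : nmodType) N (F : {set 'I_N} -> V) :
  \sum_(i < 2 ^ N) F (ones i) = \sum_x F x.
Proof.
by rewrite [RHS](reindex ones)//; exists of_set => x _; [rewrite onesK|rewrite of_setK].
Qed.

(** * Partial transposes and positive semidefinite matrices *)

Section Mx.
Variable R : realType.
Local Notation C := R[i]%C.
Implicit Type N : nat.

Lemma ptransE N (S : {set 'I_N}) (A : 'M[C]_(2 ^ N)) i j :
  ptrans S A i j = A (of_set (ones j :&: S :|: ones i :\: S))
                     (of_set (ones i :&: S :|: ones j :\: S)).
Proof.
rewrite mxE; congr (A _ _); apply/val_inj; rewrite /= val_insubd of_bits_lt;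
  by apply: eq_of_bits => k; rewrite !inE; case: (k \in S); rewrite ?andbT ?andbF ?orbF.
Qed.

Lemma ptrans0 N (A : 'M[C]_(2 ^ N)) : ptrans set0 A = A.
Proof. by apply/matrixP => i j; rewrite ptransE !setI0 !setD0 !set0U !onesK. Qed.

Lemma ptransD N (S : {set 'I_N}) (A B : 'M[C]_(2 ^ N)) :
  ptrans S (A + B) = ptrans S A + ptrans S B.
Proof. by apply/matrixP => i j; rewrite !mxE. Qed.

Lemma ptransZ N (S : {set 'I_N}) a (A : 'M[C]_(2 ^ N)) :
  ptrans S (a *: A) = a *: ptrans S A.
Proof. by apply/matrixP => i j; rewrite !mxE. Qed.

Lemma ptrans_sum N (S : {set 'I_N}) I (r : seq I) (P : pred I) (A : I -> 'M[C]_(2 ^ N)) :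
  ptrans S (\sum_(l <- r | P l) A l) = \sum_(l <- r | P l) ptrans S (A l).
Proof.
apply: (big_morph (ptrans S)); first exact: ptransD.
by apply/matrixP => i j; rewrite !mxE.
Qed.

Lemma card_ptrans N (S x y : {set 'I_N}) :
  #|y :&: S :|: x :\: S| = (#|y :&: S| + #|x :\: S|)%N.
Proof.
rewrite cardsU (_ : y :&: S :&: (x :\: S) = set0) ?cards0 ?subn0//.
by apply/setP => k; rewrite !inE; case: (k \in S); rewrite ?andbF.
Qed.

Lemma quadE n (A : 'M[C]_n) (v : 'cV_n) :
  (adjmx v *m A *m v) 0 0 = \sum_i \sum_j (v i 0)^* * A i j * v j 0.
Proof.
rewrite mxE exchange_big; apply: eq_bigr => i _; rewrite mxE mulr_suml.
by apply: eq_bigr => j _; rewrite !mxE.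
Qed.

Lemma adjmxD m n (A B : 'M[C]_(m, n)) : adjmx (A + B) = adjmx A + adjmx B.
Proof. by apply/matrixP => i j; rewrite !mxE rmorphD. Qed.

Lemma adjmxZ m n a (A : 'M[C]_(m, n)) : adjmx (a *: A) = a^* *: adjmx A.
Proof. by apply/matrixP => i j; rewrite !mxE rmorphM. Qed.

Lemma adjmxM m n p (A : 'M[C]_(m, n)) (B : 'M[C]_(n, p)) :
  adjmx (A *m B) = adjmx B *m adjmx A.
Proof. by rewrite /adjmx trmx_mul map_mxM. Qed.

Lemma psdD n (A B : 'M[C]_n) : psd A -> psd B -> psd (A + B).
Proof.
move=> [hA pA] [hB pB]; split=> [|v].
  by rewrite adjmxD hA hB.
by rewrite mulmxDr mulmxDl mxE addr_ge0.
Qed.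

Lemma psdZ n (A : 'M[C]_n) (a : C) : 0 <= a -> psd A -> psd (a *: A).
Proof.
move=> a0 [hA pA]; split=> [|v].
  by rewrite adjmxZ hA (CrealP (ger0_real _)).
by rewrite -scalemxAr -scalemxAl mxE mulr_ge0.
Qed.

Lemma psd0 n : psd (0 : 'M[C]_n).
Proof.
split; first by apply/matrixP => i j; rewrite !mxE rmorph0.
by move=> v; rewrite mulmx0 mul0mx mxE.
Qed.

Lemma psd_sum n I (r : seq I) (P : pred I) (A : I -> 'M[C]_n) :
  (forall i, P i -> psd (A i)) -> psd (\sum_(i <- r | P i) A i).
Proof. by move=> h; apply: big_ind h; [exact: psd0 | exact: psdD]. Qed.

Lemma psd_rank1 n (h : 'I_n -> C) : psd (\matrix_(i, j) (h i * (h j)^*) : 'M[C]_n).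
Proof.
split=> [|v]; first by apply/matrixP => i j; rewrite !mxE rmorphM /= conjCK mulrC.
rewrite quadE; set z := \sum_i (v i 0)^* * h i.
rewrite (_ : \sum_i _ = z * z^*) ?mul_conjC_ge0// rmorph_sum mulr_suml.
apply: eq_bigr => i _; rewrite mulr_sumr; apply: eq_bigr => j _.
by rewrite mxE rmorphM /= conjCK; ring.
Qed.

Lemma psd_gram n (T : finType) (a : T -> C) (h : T -> 'I_n -> C) (A : 'M[C]_n) :
  (forall t, 0 <= a t) ->
  (forall i j, A i j = \sum_t a t * (h t i * (h t j)^*)) -> psd A.
Proof.
move=> a0 eA.
rewrite (_ : A = \sum_t a t *: \matrix_(i, j) (h t i * (h t j)^*)).
  by apply: psd_sum => t _; apply/psdZ/psd_rank1.
by apply/matrixP => i j; rewrite eA summxE; apply: eq_bigr => t _; rewrite !mxE.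
Qed.

Lemma psd_herm n (A : 'M[C]_n) i j : psd A -> A i j = (A j i)^*.
Proof. by move=> [hA _]; rewrite -[in LHS]hA /adjmx !mxE. Qed.

(* Expand the form at [v + t A v] with [t < 0] small. *)
Lemma psd_ker n (A : 'M[C]_n) (v : 'cV_n) :
  psd A -> (adjmx v *m A *m v) 0 0 = 0 -> A *m v = 0.
Proof.
move=> [hA pA] v0; set w := A *m v.
pose q := (adjmx w *m A *m w) 0 0; pose m := (adjmx w *m w) 0 0.
have q0 : 0 <= q by exact: pA.
have mE : m = \sum_i `|w i 0| ^+ 2.
  by rewrite /m mxE; apply: eq_bigr => i _; rewrite !mxE mulrC normCK.
have m0 : 0 <= m by rewrite mE sumr_ge0// => i _; rewrite exprn_ge0.
have key (t : C) : t^* = t -> 0 <= 2 * t * m + t ^+ 2 * q.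
  move=> rt; have := pA (v + t *: w).
  have wA : adjmx v *m A = adjmx w by rewrite adjmxM hA.
  have -> : adjmx (v + t *: w) *m A *m (v + t *: w) =
      adjmx v *m A *m v + (2 * t) *: (adjmx w *m w) + t ^+ 2 *: (adjmx w *m A *m w).
    rewrite adjmxD adjmxZ rt !mulmxDl -!scalemxAl !mulmxDr -!scalemxAr wA.
    rewrite -[adjmx w *m A *m v]mulmxA -/w scalerDr scalerA -expr2.
    by rewrite mulr_natl mulr2n scalerDl !addrA.
  have linE (M M' M'' : 'M[C]_1) a b :
      (M + a *: M' + b *: M'') 0 0 = M 0 0 + a * M' 0 0 + b * M'' 0 0.
    by rewrite !mxE.
  by rewrite linE v0 add0r.
have {key} mz : m = 0.
  have q1 : 0 < q + 1 by rewrite ltr_wpDl.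
  have rt : (- m / (q + 1))^* = - m / (q + 1).
    by apply/CrealP; rewrite realM ?realN ?realV ?ger0_real// ltW.
  have := key _ rt.
  rewrite (_ : _ + _ = - (m ^+ 2 * (q + 2) / (q + 1) ^+ 2)); last first.
    by field; rewrite gt_eqF.
  rewrite oppr_ge0 => le0.
  have : m ^+ 2 * (q + 2) / (q + 1) ^+ 2 = 0.
    apply/eqP; rewrite eq_le le0/= divr_ge0 ?mulr_ge0 ?exprn_ge0 ?addr_ge0 ?ler01//.
  have q2 : 0 < q + 2 by rewrite ltr_wpDl.
  move/eqP; rewrite !mulf_eq0 invr_eq0 !expf_eq0/= (gt_eqF q1) (gt_eqF q2).
  by rewrite orbb !orbF => /eqP.
apply/matrixP => i k; rewrite ord1 [RHS]mxE; apply/eqP.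
have /eqP := mz; rewrite mE psumr_eq0; last by move=> j _; rewrite exprn_ge0.
by move=> /allP /(_ i (mem_index_enum _)); rewrite /= expf_eq0/= normr_eq0.
Qed.

Lemma psd_add_ker n (A B : 'M[C]_n) (v : 'cV_n) :
  psd A -> psd B -> (A + B) *m v = 0 -> A *m v = 0.
Proof.
move=> pA pB ABv; apply: psd_ker => //.
have := ABv => /(congr1 (fun w => (adjmx v *m w) 0 0)).
rewrite mulmx0 mulmxA mulmxDr mulmxDl mxE [RHS]mxE => /eqP.
by rewrite paddr_eq0 ?pA.2 ?pB.2// => /andP[/eqP].
Qed.

Lemma psd_add_rel3 n (A B : 'M[C]_n) (j1 j2 j3 : 'I_n) (a b c : C) :
  psd A -> psd B ->
  (forall i, a * (A + B) i j1 + b * (A + B) i j2 + c * (A + B) i j3 = 0) ->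
  forall i, a * A i j1 + b * A i j2 + c * A i j3 = 0.
Proof.
move=> pA pB h i.
pose v : 'cV[C]_n := a *: delta_mx j1 0 + b *: delta_mx j2 0 + c *: delta_mx j3 0.
have vE (M : 'M[C]_n) k : (M *m v) k 0 = a * M k j1 + b * M k j2 + c * M k j3.
  by rewrite !mulmxDr -!scalemxAr -!colE !mxE.
rewrite -vE (psd_add_ker pA pB) ?mxE//.
by apply/matrixP => k l; rewrite ord1 vE h mxE.
Qed.

End Mx.

(** * Rank of a sum of rank-one matrices *)

Lemma rank_sum_rank1 (F : fieldType) n (T : finType) (P : pred T)
    (a : T -> F) (h : T -> 'I_n -> F) (A : 'M_n) :
  (forall t, P t -> a t != 0) ->
  (forall c, (forall i, \sum_t c t * h t i = 0) -> forall t, c t = 0) ->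
  (forall i j, A i j = \sum_(t | P t) a t * (h t i * h t j)) ->
  \rank A = #|P|.
Proof.
move=> a0 indep eA.
pose H : 'M_(#|P|, n) := \matrix_(k, j) h (enum_val k) j.
pose D : 'M_(#|P|) := diag_mx (\row_k a (enum_val k)).
have -> : A = H^T *m D *m H.
  apply/matrixP => i j; rewrite eA mul_mx_diag mxE big_enum_val /=.
  by apply: eq_bigr => k _; rewrite !mxE mulrA [_ * a _]mulrC.
have freeH : row_free H.
  apply/inj_row_free => v vH0; apply/rowP => k; rewrite mxE.
  pose c t := \sum_l v 0 l * (enum_val l == t)%:R.
  have := indep c _ (enum_val k); rewrite {2}/c (bigD1 k)//= eqxx mulr1 big1 => [|l lk].
    rewrite addr0; apply=> i; have := congr1 (fun w : 'rV_n => w 0 i) vH0; rewrite !mxE.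
    apply: etrans; rewrite /c; under eq_bigr do rewrite mulr_suml.
        rewrite exchange_big; apply: eq_bigr => l _ /=; rewrite mxE.
    rewrite (bigD1 (enum_val l))//= eqxx mulr1 big1 ?addr0// => t /negPf.
    by rewrite eq_sym => ->; rewrite mulr0 mul0r.
  by rewrite (inj_eq enum_val_inj) (negPf lk) mulr0.
have freeD : row_free D.
  rewrite row_free_unit unitmxE det_diag unitfE.
  apply/prodf_neq0 => k _; by rewrite mxE a0//; have := enum_valP k.
by rewrite (mxrankMfree _ freeH) (mxrankMfree _ freeD) mxrank_tr; apply/eqP.
Qed.

Lemma rec2_zero (V : comPzRingType) (h : nat -> V) z L k0 :
  (forall p, (p + 2 <= L)%N -> h p - z * h (p + 1)%N + h (p + 2)%N = 0) ->
  (k0 + 1 <= L)%N -> h k0 = 0 -> h (k0 + 1)%N = 0 ->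
  forall p, (p <= L)%N -> h p = 0.
Proof.
move=> rec k0L h0 h1.
have up n : (k0 + n + 1 <= L)%N -> h (k0 + n)%N = 0 /\ h (k0 + n + 1)%N = 0.
  elim: n => [|n IH] le; first by rewrite addn0.
  have [|e0 e1] := IH; first by lia.
  have := rec (k0 + n)%N; rewrite e0 e1 mulr0 subr0 add0r => e2.
  split; first by rewrite -addn1 addnA.
  by rewrite -addn1 addnA -addnA e2//; lia.
have dn n : (n <= k0)%N -> h (k0 - n)%N = 0 /\ h (k0 - n + 1)%N = 0.
  elim: n => [|n IH] le; first by rewrite subn0.
  have [|e0 e1] := IH; first by lia.
  have := rec (k0 - n.+1)%N.
  rewrite (_ : k0 - n.+1 + 1 = k0 - n)%N; last by lia.
  rewrite (_ : k0 - n.+1 + 2 = k0 - n + 1)%N; last by lia.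
  by rewrite e0 e1 mulr0 subr0 addr0 => ->//; lia.
move=> p pL; case: (leqP p k0) => [le|lt].
  by have [|<- _] := dn (k0 - p)%N; [lia | congr h; lia].
have [|_ <-] := up (p - k0 - 1)%N; first by lia.
by congr h; lia.
Qed.

(** * The sequence lambda *)

Section Sequence.
Variables (R : realType) (K : nat) (Z : R) (f : int -> R).
Hypotheses (f0 : f 0 = 1) (f1 : f 1 = 1 + Z).
Hypothesis frec : forall k : int, f (k + 2) = (2 + Z) * f (k + 1) - f k.
Let N := (2 * K + 1)%N.
Let lam (k : nat) : R := f (K%:Z - k%:Z).

Lemma lam_rec k : lam k - (2 + Z) * lam (k + 1)%N + lam (k + 2)%N = 0.
Proof.
have := frec (K%:Z - (k + 2)%:Z).
rewrite (_ : K%:Z - (k + 2)%:Z + 2 = K%:Z - k%:Z); last by lia.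
rewrite (_ : K%:Z - (k + 2)%:Z + 1 = K%:Z - (k + 1)%:Z); last by lia.
by rewrite -/(lam k) -/(lam (k + 1)) -/(lam (k + 2)) => ->; ring.
Qed.

Lemma lamK : lam K = 1.
Proof. by rewrite /lam subrr. Qed.

Lemma lamK1 : lam (K + 1)%N = 1.
Proof.
have := frec (-1); rewrite (_ : -1 + 2 = 1) // (_ : -1 + 1 = 0)// f0 f1 => e.
rewrite /lam (_ : K%:Z - (K + 1)%:Z = -1); last by lia.
by lra.
Qed.

Lemma lam_sym k : (k <= N)%N -> lam (N - k)%N = lam k.
Proof.
move=> kN; apply/eqP; rewrite -subr_eq0; apply/eqP.
apply: (@rec2_zero _ (fun k => lam (N - k)%N - lam k) (2 + Z) N K) => //.
- move=> p pN; have := lam_rec p; have := lam_rec (N - (p + 2))%N.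
  rewrite (_ : N - (p + 2) + 1 = N - (p + 1))%N; last by lia.
  rewrite (_ : N - (p + 2) + 2 = N - p)%N; last by lia.
  by lra.
- by rewrite /N; lia.
- rewrite (_ : N - K = K + 1)%N; last by rewrite /N; lia.
  by rewrite lamK lamK1 subrr.
- rewrite (_ : N - (K + 1) = K)%N; last by rewrite /N; lia.
  by rewrite lamK lamK1 subrr.
Qed.

Hypothesis Z0 : 0 < Z.

Lemma f_incr (j : nat) : 1 <= f j%:Z /\ Z <= f (j + 1)%N%:Z - f j%:Z.
Proof.
have Zpos := Z0.
elim: j => [|j [ge1 geZ]]; first by rewrite f0 f1; lra.
have := frec j; rewrite (_ : j%:Z + 2 = (j.+1 + 1)%N%:Z); last by lia.
rewrite (_ : j%:Z + 1 = j.+1%:Z); last by lia.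
rewrite (_ : (j + 1)%N = j.+1) in geZ; last by lia.
have b0 : 0 <= Z * f j.+1%:Z by rewrite mulr_ge0 ?(ltW Z0)//; lra.
by move=> ->; split; lra.
Qed.

Lemma lam_ge1 k : (k <= N)%N -> 1 <= lam k.
Proof.
wlog kK : k / (k <= K)%N => [h kN|_].
  case: (leqP k K) => [|lt]; first by move=> ?; exact: h.
  by rewrite -(lam_sym kN); apply: h; rewrite /N in kN *; lia.
by have [] := f_incr (K - k)%N; rewrite -subzn.
Qed.

Lemma lam_gt1 k : (k < K)%N -> 1 < lam k.
Proof.
have Zpos := Z0.
move=> kK; have [ge1 geZ] := f_incr (K - k - 1)%N.
rewrite (_ : K - k - 1 + 1 = K - k)%N in geZ; last by lia.
by rewrite /lam subzn; [lra|exact: ltnW].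
Qed.

Lemma lam_exp : exists s u, [/\ 0 < s, 0 < u, s != u, s * u = 1 &
  (s + u) ^+ 2 = 4 + Z /\ forall k, (k <= N)%N ->
    lam k = u ^+ N / (s + u) * s ^+ (2 * k) + s ^+ N / (s + u) * u ^+ (2 * k)].
Proof.
have Zpos := Z0.
pose y := Num.sqrt Z; pose x := Num.sqrt (Z + 4).
have x2 : x ^+ 2 = Z + 4 by rewrite sqr_sqrtr//; lra.
have y2 : y ^+ 2 = Z by rewrite sqr_sqrtr//; lra.
have x0 : 0 < x by rewrite sqrtr_gt0; lra.
have y0 : 0 < y by rewrite sqrtr_gt0; lra.
have xy : y < x by rewrite ltr_sqrt; lra.
pose s := (x + y) / 2; pose u := (x - y) / 2.
have su : s * u = 1.
  by rewrite (_ : _ * _ = (x ^+ 2 - y ^+ 2) / 4); [rewrite x2 y2; lra | rewrite /s /u; field].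
have spu : s + u = x by rewrite /s /u; field.
have spu0 : s + u != 0 by rewrite spu gt_eqF.
exists s, u; split => //; rewrite /s /u; [lra|lra|rewrite eq_sym lt_eqF//; lra|].
rewrite -/s -/u; split; first by rewrite spu x2 addrC.
have s2u2 : s ^+ 2 + u ^+ 2 = 2 + Z.
  by rewrite (_ : _ + _ = (s + u) ^+ 2 - 2 * (s * u)); [rewrite spu x2 su; lra | ring].
pose E k := u ^+ N / (s + u) * s ^+ (2 * k) + s ^+ N / (s + u) * u ^+ (2 * k).
have SU : s ^+ K * u ^+ K = 1 by rewrite -exprMn su expr1n.
have eN (r : R) : r ^+ N = (r ^+ K) ^+ 2 * r by rewrite /N exprD expr1 mulnC exprM.
have e2 (r : R) k : r ^+ (2 * k) = (r ^+ k) ^+ 2 by rewrite mulnC exprM.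
have EK : E K = 1.
  rewrite /E !e2 !eN -[RHS](_ : (s ^+ K * u ^+ K) ^+ 2 = 1); last by rewrite SU expr1n.
  by field.
have EK1 : E (K + 1)%N = 1.
  rewrite /E !e2 !eN exprD exprD.
  rewrite -[RHS](_ : (s ^+ K * u ^+ K) ^+ 2 * (s * u) = 1); last by rewrite SU su expr1n mulr1.
  by field.
have Erec p : E p - (2 + Z) * E (p + 1)%N + E (p + 2)%N = 0.
  rewrite -s2u2 /E !mulnDr muln1 (_ : 2 * 2 = 4)%N//.
  rewrite !(exprD _ (2 * p) 2) !(exprD _ (2 * p) 4).
  move: (s ^+ (2 * p)) (u ^+ (2 * p)) (u ^+ N) (s ^+ N) => P Q U S.
  rewrite (_ : _ + _ = (U / (s + u) * P + S / (s + u) * Q) * (1 - (s * u) ^+ 2)).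
    by rewrite su expr1n subrr mulr0.
  by ring.
move=> k kN; apply/eqP; rewrite -subr_eq0; apply/eqP.
apply: (@rec2_zero _ (fun k => lam k - E k) (2 + Z) N K) => //.
- move=> p _ /=; move: (lam_rec p) (Erec p).
  move: (lam _) (lam _) (lam _) (E _) (E _) (E _) => a b c a' b' c'; lra.
- by rewrite /N; lia.
- by rewrite lamK EK subrr.
- by rewrite lamK1 EK1 subrr.
Qed.

End Sequence.

(** * Decomposition of the partial transposes *)

Lemma exists_split N (S : {set 'I_N}) i j : (i <= #|S|)%N -> (j <= N - #|S|)%N ->
  exists x : {set 'I_N}, #|x :&: S| = i /\ #|x :\: S| = j.
Proof.
have sub (A : {set 'I_N}) k : (k <= #|A|)%N -> exists2 B : {set 'I_N}, B \subset A & #|B| = k.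
  move=> kA; exists [set x in take k (enum A)].
    by apply/subsetP => x; rewrite inE => /mem_take; rewrite mem_enum.
  rewrite cardsE; have /card_uniqP -> : uniq (take k (enum A)) by rewrite take_uniq ?enum_uniq.
  by rewrite size_take -cardE; case: ltngtP kA.
move=> /sub[A AS Ai] jS; have [|B BS Bj] := sub (~: S) j.
  by have := cardsC S; rewrite card_ord; lia.
have BS0 : B :&: S = set0 by apply/disjoint_setI0; rewrite disjoints_subset.
exists (A :|: B); rewrite setIUl setDUl (setIidPl AS) BS0 setU0 Ai; split => //.
have /eqP -> : A :\: S == set0 by rewrite setD_eq0.
by rewrite set0U setDE (setIidPl BS).
Qed.

Lemma card_split N (S x : {set 'I_N}) :
  [/\ (#|x :&: S| <= #|S|)%N, (#|x :\: S| <= N - #|S|)%N,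
      #|x| = (#|x :&: S| + #|x :\: S|)%N,
      (x == S) = (#|x :&: S| == #|S|) && (#|x :\: S| == 0%N) &
      (x == ~: S) = (#|x :&: S| == 0%N) && (#|x :\: S| == N - #|S|)%N].
Proof.
have cS : #|~: S| = (N - #|S|)%N by have := cardsC S; rewrite card_ord; lia.
have xD : x :\: S \subset ~: S by rewrite setDE subsetIr.
split.
- by rewrite subset_leq_card ?subsetIr.
- by rewrite -cS subset_leq_card.
- by rewrite cardsID.
- rewrite cards_eq0 setD_eq0 eqEsubset andbC; congr andb.
  by rewrite (eq_leqif (subset_leqif_cards (subsetIr x S))) eqEsubset subsetIr subsetI subxx andbT.
- rewrite cards_eq0 setI_eq0 disjoints_subset -cS (eq_leqif (subset_leqif_cards xD)).
  by rewrite eqEsubset setDE [in RHS]eqEsubset subsetIr subsetI subxx andbT.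
Qed.

Lemma sum_level (R : realType) N (a b : nat) :
  \sum_(l < N.-1) (a == l.+1)%:R * (b == l.+1)%:R = ((a == b) && (0 < a < N)%N)%:R :> R.
Proof.
have [/andP[a0 aN]|naN] := boolP (0 < a < N)%N.
  have lt : (a.-1 < N.-1)%N by lia.
  rewrite (bigD1 (Ordinal lt))//= prednK// eqxx mul1r big1 ?addr0 ?andbT 1?eq_sym// => l.
  rewrite -val_eqE /= => ne; have -> : (a == l.+1) = false by lia.
  by rewrite mul0r.
rewrite andbF big1// => l _; have -> : (a == l.+1) = false by have := ltn_ord l; lia.
by rewrite mul0r.
Qed.

Section Decomposition.
Variables (R : realType) (lam : nat -> R) (sg : R) (N : nat).
Hypotheses (N0 : (0 < N)%N) (lamsym : forall k, (k <= N)%N -> lam (N - k)%N = lam k).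
Hypothesis sg2 : sg * sg = 1.

Definition dicke_coef (p q : nat) : R := (p == q)%:R * lam p
  + sg * ((p == 0%N) && (q == N) || (p == N) && (q == 0%N))%:R.

Lemma dicke_coef_diag p : dicke_coef p p = lam p.
Proof.
rewrite /dicke_coef eqxx mul1r (_ : _ && _ || _ = false) ?mulr0 ?addr0//.
by case: eqP => [->|_]; rewrite ?andbF// (ltn_eqF N0).
Qed.

Lemma dicke_coef01 : (1 < N)%N -> dicke_coef 0 1 = 0.
Proof. by move=> N1; rewrite /dicke_coef !(ltn_eqF N1) (ltn_eqF N0) mul0r mulr0 addr0. Qed.

Definition pt_coef (S x y : {set 'I_N}) : R :=
  dicke_coef (#|y :&: S| + #|x :\: S|) (#|x :&: S| + #|y :\: S|).

Definition corner (S : {set 'I_N}) (b : bool) (x : {set 'I_N}) : R :=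
  (x == S)%:R + (-1) ^+ b * sg * (x == ~: S)%:R.

Definition hdist (S x : {set 'I_N}) : nat := (#|x :\: S| + (#|S| - #|x :&: S|))%N.

Lemma pt_coefE S x y : pt_coef S x y =
  ((hdist S x == hdist S y) && (0 < hdist S x < N)%N)%:R * lam (#|y :&: S| + #|x :\: S|)
  + \sum_(b : bool) (lam #|S| + (-1) ^+ b) / 2 * (corner S b x * corner S b y).
Proof.
rewrite big_bool /= /corner expr1 expr0 !mul1r !mulN1r.
have mN : (#|S| <= N)%N by rewrite -[N in (_ <= N)%N]card_ord max_card.
have lm := lamsym mN.
have [h1 h2 _ -> ->] := card_split S x; have [h3 h4 _ -> ->] := card_split S y.
rewrite /pt_coef /dicke_coef /hdist.
move: #|x :&: S| #|y :&: S| #|x :\: S| #|y :\: S| #|S| mN lm h1 h2 h3 h4.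
move=> i i' j j' m mN lm im jm i'm j'm.
have [e1|ne1] := boolP ((i == m) && (j == 0%N)).
  have -> : (i == 0%N) && (j == N - m)%N = false by lia.
  have [e2|ne2] := boolP ((i' == m) && (j' == 0%N)).
    have -> : (i' == 0%N) && (j' == N - m)%N = false by lia.
    have -> : (i' + j == i + j')%N by lia.
    have -> : (i' + j == 0)%N && (i + j' == N)%N || (i' + j == N)%N && (i + j' == 0)%N = false by lia.
    have -> : (j + (m - i) == j' + (m - i'))%N && (0 < j + (m - i) < N)%N = false by lia.
    have -> : (i' + j = m)%N by lia.
    by rewrite /=; field.
  have -> : (i' + j == i + j')%N = false by lia.
  have -> : (j + (m - i) == j' + (m - i'))%N && (0 < j + (m - i) < N)%N = false by lia.
  have [e3|ne3] := boolP ((i' == 0%N) && (j' == N - m)%N).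
    have -> : (i' + j == 0)%N && (i + j' == N)%N || (i' + j == N)%N && (i + j' == 0)%N by lia.
    by rewrite /=; field.
  have -> : (i' + j == 0)%N && (i + j' == N)%N || (i' + j == N)%N && (i + j' == 0)%N = false by lia.
  by rewrite /=; field.
have [e3|ne3] := boolP ((i == 0%N) && (j == N - m)%N).
  have -> : (j + (m - i) == j' + (m - i'))%N && (0 < j + (m - i) < N)%N = false by lia.
  have [e2|ne2] := boolP ((i' == m) && (j' == 0%N)).
    have -> : (i' == 0%N) && (j' == N - m)%N = false by lia.
    have -> : (i' + j == i + j')%N = false by lia.
    have -> : (i' + j == 0)%N && (i + j' == N)%N || (i' + j == N)%N && (i + j' == 0)%N by lia.
    by rewrite /=; field.
  have -> : (i' + j == 0)%N && (i + j' == N)%N || (i' + j == N)%N && (i + j' == 0)%N = false by lia.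
  have [e4|ne4] := boolP ((i' == 0%N) && (j' == N - m)%N).
    have -> : (i' + j == i + j')%N by lia.
    have -> : (i' + j = N - m)%N by lia.
    rewrite lm /=.
    transitivity ((sg * sg) * lam m); first by rewrite sg2 /=; ring.
    by rewrite /=; field.
  have -> : (i' + j == i + j')%N = false by lia.
  by rewrite /=; field.
have -> : (i' + j == 0)%N && (i + j' == N)%N || (i' + j == N)%N && (i + j' == 0)%N = false by lia.
have [e2|ne2] := boolP ((i' == m) && (j' == 0%N)).
  have -> : (i' + j == i + j')%N = false by lia.
  have -> : (j + (m - i) == j' + (m - i'))%N && (0 < j + (m - i) < N)%N = false by lia.
  by rewrite /=; field.
have [e4|ne4] := boolP ((i' == 0%N) && (j' == N - m)%N).
  have -> : (i' + j == i + j')%N = false by lia.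
  have -> : (j + (m - i) == j' + (m - i'))%N && (0 < j + (m - i) < N)%N = false by lia.
  by rewrite /=; field.
have -> : (j + (m - i) == j' + (m - i'))%N && (0 < j + (m - i) < N)%N = (i' + j == i + j')%N by lia.
by rewrite /=; field.
Qed.

Definition pt_mx (S : {set 'I_N}) : 'M[R]_(2 ^ N) := \matrix_(i, j) pt_coef S (ones i) (ones j).

Lemma dicke_rank : (forall k, (k <= N)%N -> 1 <= lam k) -> 1 < lam 0%N ->
  \rank (pt_mx set0) = N.+1.
Proof.
move=> lam1 lam0.
pose a (t : 'I_N.-1 + bool) : R := match t with inl l => lam l.+1 | inr b => (lam 0%N + (-1) ^+ b) / 2 end.
pose h (t : 'I_N.-1 + bool) (i : 'I_(2 ^ N)) : R :=
  match t with inl l => (#|ones i| == l.+1)%:R | inr b => corner set0 b (ones i) end.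
have hd x : hdist set0 x = #|x| by rewrite /hdist setD0 setI0 cards0 addn0.
rewrite (@rank_sum_rank1 _ _ _ predT a h); first by rewrite card_sum card_bool card_ord; lia.
- case=> [l|b] _ /=; first by rewrite gt_eqF// (lt_le_trans ltr01)// lam1//; have := ltn_ord l; lia.
  by rewrite gt_eqF//; case: b; rewrite ?expr1 ?expr0; lra.
- move=> c c0.
  have vecE (x : {set 'I_N}) : \sum_(l < N.-1) c (inl l) * (#|x| == l.+1)%:R +
    (c (inr true) * corner set0 true x + c (inr false) * corner set0 false x) = 0.
    rewrite -[RHS](c0 (of_set x)) big_sumType big_bool /= of_setK.
    by congr (_ + _).
  have T0 : (setT == set0 :> {set 'I_N}) = false by rewrite -cards_eq0 cardsT card_ord; lia.
  have [cr1 cr2] : c (inr true) = 0 /\ c (inr false) = 0.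
    have := vecE set0; rewrite big1 => [|l _]; last by rewrite cards0 mulr0.
    rewrite /corner setC0 eqxx eq_sym T0 expr1 expr0 !mulr0 !addr0 !mulr1 add0r => e1.
    have := vecE setT; rewrite big1 => [|l _]; last first.
      rewrite cardsT card_ord; have -> : (N == l.+1) = false by have := ltn_ord l; lia.
      by rewrite mulr0.
    rewrite /corner setC0 eqxx T0 expr1 expr0 !add0r => e2.
    have e3 : sg * (c (inr false) - c (inr true)) = 0 by rewrite -[RHS]e2 /=; ring.
    have e4 : c (inr false) - c (inr true) = 0.
      by rewrite -[LHS]mul1r -sg2 -mulrA e3 mulr0.
    by split; lra.
  case=> [l|[]//].
  have [||x [_ xl]] := @exists_split N set0 0 l.+1; rewrite ?cards0//.
    by have := ltn_ord l; lia.
  have := vecE x; rewrite cr1 cr2 !mul0r !addr0.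
  rewrite setD0 in xl; rewrite xl (bigD1 l)//= eqxx mulr1 big1 ?addr0// => k.
  by rewrite -val_eqE /= eqSS eq_sym => /negPf ->; rewrite mulr0.
move=> i j; rewrite mxE pt_coefE big_sumType /= cards0; congr (_ + _).
rewrite !hd setI0 setD0 cards0 add0n -sum_level mulr_suml; apply: eq_bigr => l _.
by case: eqP => [->|_] /=; [rewrite mulrC | rewrite !mul0r mulr0].
Qed.

Variables s u : R.
Hypothesis lamE : forall k, (k <= N)%N ->
  lam k = u ^+ N / (s + u) * s ^+ (2 * k) + s ^+ N / (s + u) * u ^+ (2 * k).

Definition pt_index : predArgType := ('I_N.-1 * bool + bool)%type.

Definition pt_weight (S : {set 'I_N}) (t : pt_index) : R :=
  match t with
  | inl p => (if p.2 then u else s) ^+ N / (s + u)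
  | inr b => (lam #|S| + (-1) ^+ b) / 2
  end.

Definition pt_vec (S : {set 'I_N}) (t : pt_index) (x : {set 'I_N}) : R :=
  match t with
  | inl p => (hdist S x == p.1.+1)%:R * (if p.2 then s else u) ^+ #|x|
  | inr b => corner S b x
  end.

Lemma pt_coef_sum S x y :
  pt_coef S x y = \sum_t pt_weight S t * (pt_vec S t x * pt_vec S t y).
Proof.
rewrite pt_coefE big_sumType /=; congr (_ + _).
rewrite -(pair_bigA _ (fun (l : 'I_N.-1) (b : bool) => (if b then u else s) ^+ N / (s + u) *
  ((hdist S x == l.+1)%:R * (if b then s else u) ^+ #|x| *
   ((hdist S y == l.+1)%:R * (if b then s else u) ^+ #|y|)))) /=.
under eq_bigr => l _.
  rewrite big_bool /=.
  rewrite (_ : _ + _ = (hdist S x == l.+1)%:R * (hdist S y == l.+1)%:R *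
     (u ^+ N / (s + u) * (s ^+ #|x| * s ^+ #|y|) + s ^+ N / (s + u) * (u ^+ #|x| * u ^+ #|y|))).
    over.
  by ring.
rewrite -mulr_suml sum_level; case: (boolP (_ == _)) => [/eqP d|_]; last by rewrite !mul0r.
have [h1 h2 cx _ _] := card_split S x; have [h3 h4 cy _ _] := card_split S y.
have mN : (#|S| <= N)%N by rewrite -[N in (_ <= N)%N]card_ord max_card.
congr (_ * _); rewrite lamE; last by rewrite (leq_trans (leq_add h3 h2))// subnKC.
rewrite -!exprD (_ : 2 * _ = #|x| + #|y|)%N//.
move: d h1 h3; rewrite /hdist cx cy.
by move: #|x :&: S| #|y :&: S| #|x :\: S| #|y :\: S| #|S|; lia.
Qed.

Hypotheses (s0 : 0 < s) (u0 : 0 < u) (sNu : s != u).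

Lemma pt_indep (S : {set _}) (c : pt_index -> R) : (0 < #|S| < N)%N ->
  (forall x, \sum_t c t * pt_vec S t x = 0) -> forall t, c t = 0.
Proof.
move=> SN c0.
have vecE x : \sum_(l < N.-1) (hdist S x == l.+1)%:R *
    (c (inl (l, true)) * s ^+ #|x| + c (inl (l, false)) * u ^+ #|x|) +
    (c (inr true) * corner S true x + c (inr false) * corner S false x) = 0.
  rewrite -[RHS](c0 x) big_sumType big_bool; congr (_ + _) => /=.
  pose G (l : 'I_N.-1) (b : bool) := c (inl (l, b)) *
    ((hdist S x == l.+1)%:R * (if b then s else u) ^+ #|x|).
  rewrite [RHS](eq_bigr (fun p => G p.1 p.2)) => [|[]//].
  rewrite -(pair_bigA _ G) /G /=.
  by apply: eq_bigr => l _; rewrite big_bool /=; ring.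
have zero_out x : (hdist S x == 0%N) || (hdist S x == N) ->
    c (inr true) * corner S true x + c (inr false) * corner S false x = 0.
  move=> hx; have := vecE x; rewrite big1 ?add0r// => l _.
  have -> : (hdist S x == l.+1) = false by have := ltn_ord l; lia.
  by rewrite mul0r.
have cS : #|~: S| = (N - #|S|)%N by have := cardsC S; rewrite card_ord; lia.
have SC : (S == ~: S) = false.
  have [_ _ _ _ ->] := card_split S S; rewrite setIid setDv cards0; lia.
have [cr1 cr2] : c (inr true) = 0 /\ c (inr false) = 0.
  have := zero_out S; rewrite /hdist setDv setIid cards0 subnn => /(_ isT).
  rewrite /corner eqxx SC expr1 expr0 !mulr0 !addr0 !mulr1 => e1.
  have := zero_out (~: S); rewrite /hdist [~: S :&: S]setIC setICr cards0 subn0 setDE setIid cS subnK; last by lia.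
  rewrite eqxx orbT => /(_ isT).
  rewrite /corner eqxx [_ == S]eq_sym SC expr1 expr0 !add0r => e2.
  have e3 : sg * (c (inr false) - c (inr true)) = 0 by rewrite -[RHS]e2 /=; ring.
  have e4 : c (inr false) - c (inr true) = 0.
    by rewrite -[LHS]mul1r -sg2 -mulrA e3 mulr0.
  by split; lra.
have cl (l : 'I_N.-1) i j : (i <= #|S|)%N -> (j <= N - #|S|)%N -> (j + (#|S| - i) = l.+1)%N ->
    c (inl (l, true)) * s ^+ (i + j) + c (inl (l, false)) * u ^+ (i + j) = 0.
  move=> iS jS ij; have [x [xi xj]] := exists_split iS jS.
  have [_ _ cx _ _] := card_split S x.
  have := vecE x; rewrite cr1 cr2 !mul0r !addr0 cx xi xj (bigD1 l)//=.
  rewrite /hdist xi xj ij eqxx mul1r big1 ?addr0// => k.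
  by rewrite -val_eqE /= eqSS eq_sym => /negPf ->; rewrite mul0r.
case=> [[l b]|[]//].
have [i [j [iS jS ij]]] : exists i j, [/\ (i < #|S|)%N, (j < N - #|S|)%N & (j + (#|S| - i) = l.+1)%N].
  have := ltn_ord l; case: (ltnP l.+1 #|S|) => lS lN.
    by exists (#|S| - l.+1)%N, 0%N; split; lia.
  by exists 0%N, (l.+1 - #|S|)%N; split; lia.
have e1 := cl l i j (ltnW iS) (ltnW jS) ij.
have e2 : c (inl (l, true)) * (s ^+ (i + j) * s ^+ 2) + c (inl (l, false)) * (u ^+ (i + j) * u ^+ 2) = 0.
  rewrite -!exprD (_ : i + j + 2 = i.+1 + j.+1)%N; last by lia.
  by apply: cl; lia.
have su2 : s ^+ 2 - u ^+ 2 != 0.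
  by rewrite subr_sqr mulf_neq0 ?subr_eq0// gt_eqF// addr_gt0.
have z1 : c (inl (l, true)) * s ^+ (i + j) = 0.
  apply: (mulIf su2); rewrite mul0r; move: e1 e2.
  move: (s ^+ (i + j)) (u ^+ (i + j)) (c (inl (l, true))) (c (inl (l, false))) => P Q a b1 e1 e2.
  transitivity (a * (P * s ^+ 2) + b1 * (Q * u ^+ 2) - (a * P + b1 * Q) * u ^+ 2); first by ring.
  by rewrite e1 e2 mul0r subr0.
have ct : c (inl (l, true)) = 0.
  by move/eqP: z1; rewrite mulf_eq0 expf_eq0 (gt_eqF s0) andbF orbF => /eqP.
case: b => //; move/eqP: e1; rewrite ct mul0r add0r mulf_eq0 expf_eq0 (gt_eqF u0) andbF orbF.
by move/eqP.
Qed.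

Lemma pt_weightl_gt0 S p : 0 < pt_weight S (inl p).
Proof. by rewrite /= divr_gt0 ?addr_gt0 ?exprn_gt0//; case: ifP. Qed.

Lemma pt_mx_rank (S : {set _}) (P : pred pt_index) : (0 < #|S| < N)%N ->
  (forall t, P t = (pt_weight S t != 0)) -> \rank (pt_mx S) = #|P|.
Proof.
move=> SN PE.
apply: (@rank_sum_rank1 _ _ _ P (pt_weight S) (fun t i => pt_vec S t (ones i))).
- by move=> t; rewrite PE.
- move=> c c0; apply: (pt_indep SN) => x; have := c0 (of_set x).
  by under eq_bigr do rewrite of_setK.
- move=> i j; rewrite mxE pt_coef_sum (bigID P)/= [X in _ + X]big1 ?addr0// => t.
  by rewrite PE negbK => /eqP ->; rewrite mul0r.
Qed.

Lemma pt_mx_psd (S : {set _}) (c : R) : 0 <= c -> (forall k, (k <= N)%N -> 1 <= lam k) ->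
  psd (map_mx (real_complex R) (c *: pt_mx S)).
Proof.
move=> c0 lam1.
have mN : (#|S| <= N)%N by rewrite -[N in (_ <= N)%N]card_ord max_card.
apply: (@psd_gram _ _ _ (fun t => (c * pt_weight S t)%:C%C)
  (fun t i => (pt_vec S t (ones i))%:C%C)).
  case=> [p|b]; rewrite lecR mulr_ge0//; first exact/ltW/pt_weightl_gt0.
  by have := lam1 _ mN; case: b => /=; rewrite ?expr1 ?expr0; lra.
move=> i j; rewrite !mxE pt_coef_sum mulr_sumr rmorph_sum; apply: eq_bigr => t _.
rewrite mulrA !rmorphM /=; congr (_ * (_ * _)).
by apply/esym/CrealP/complex_realP; eexists.
Qed.

End Decomposition.

(** * Extremality *)

Section Rigidity.
Variables (R : realType) (K : nat) (lam : nat -> R) (Z sg : R).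
Local Notation C := R[i]%C.
Let N := (2 * K + 1)%N.
Hypothesis lam_rec : forall k, lam k - (2 + Z) * lam (k + 1)%N + lam (k + 2)%N = 0.

Lemma dicke_coef_rec p q : (p + 2 <= N)%N -> (q + 2 <= N)%N ->
  dicke_coef lam sg N p q - (2 + Z) * dicke_coef lam sg N (p + 1) (q + 1)
    + dicke_coef lam sg N (p + 2) (q + 2) = 0.
Proof.
move=> pN qN; rewrite /dicke_coef !(eqn_add2r _ p q).
have -> : (p == 0)%N && (q == N) || (p == N) && (q == 0)%N = false by lia.
have -> : (p + 1 == 0)%N && (q + 1 == N)%N || (p + 1 == N)%N && (q + 1 == 0)%N = false by lia.
have -> : (p + 2 == 0)%N && (q + 2 == N)%N || (p + 2 == N)%N && (q + 2 == 0)%N = false by lia.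
have lr := lam_rec p; case: eqP => [_|_] /=; last by ring.
by rewrite !mulr0 !addr0 !mul1r.
Qed.

Hypotheses (sg2 : sg * sg = 1) (lamK : lam K = 1) (lamK1 : lam (K + 1)%N = 1).

Lemma dicke_coef_link i j : (i <= K)%N -> (j <= K + 1)%N ->
  dicke_coef lam sg N (K + j) i = sg * dicke_coef lam sg N j (i + (K + 1)).
Proof.
move=> iK jK; rewrite /dicke_coef /N.
have [/andP[/eqP i0 /eqP jE]|n1] := boolP ((i == 0%N) && (j == K + 1)%N).
  rewrite i0 jE (_ : _ == _ = false); last by lia.
  rewrite (_ : _ && _ || _); last by lia.
  rewrite eqxx lamK1 (_ : _ && _ || _ = false); last by lia.
  by rewrite /=; ring.
have [/andP[/eqP iE /eqP j0]|n2] := boolP ((i == K) && (j == 0%N)).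
  rewrite iE j0 addn0 eqxx lamK (_ : _ && _ || _ = false); last by lia.
  rewrite (_ : _ == _ = false); last by lia.
  rewrite (_ : _ && _ || _); last by lia.
  by transitivity (sg * sg); [rewrite sg2 /=; ring | rewrite /=; ring].
rewrite (_ : _ == _ = false); last by lia.
rewrite (_ : _ && _ || _ = false); last by lia.
rewrite (_ : j == _ = false); last by lia.
rewrite (_ : _ && _ || _ = false); last by lia.
by rewrite /=; ring.
Qed.

Hypotheses (K0 : (0 < K)%N) (Z0 : Z != 0).
Variable g : nat -> nat -> C.
Hypothesis g_herm : forall p q, g p q = (g q p)^*.
Hypothesis g_rec : forall p q, (p + 2 <= N)%N -> (q + 2 <= N)%N ->
  g p q - (2 + Z)%:C%C * g (p + 1)%N (q + 1)%N + g (p + 2)%N (q + 2)%N = 0.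
Hypothesis g_link : forall i j, (i <= K)%N -> (j <= K + 1)%N ->
  g (K + j)%N i = sg%:C%C * g j (i + (K + 1))%N.

Let sgC2 : sg%:C%C * sg%:C%C = 1 :> C.
Proof. by rewrite -rmorphM sg2 rmorph1. Qed.

Let sgC_conj : (sg%:C%C : C)^* = sg%:C%C.
Proof. by apply/CrealP/complex_realP; eexists. Qed.

Lemma diag_zero e k0 : (k0 + 1 + e <= N)%N -> g k0 (k0 + e)%N = 0 ->
  g (k0 + 1)%N (k0 + 1 + e)%N = 0 -> forall p, (p + e <= N)%N -> g p (p + e)%N = 0.
Proof.
move=> k0N h0 h1 p pN.
apply: (@rec2_zero _ (fun p => g p (p + e)%N) (2 + Z)%:C%C (N - e) k0) => //; try lia.
move=> r rN; rewrite -[RHS](g_rec (p := r) (q := r + e)); [|lia|lia].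
by congr (_ - _ * g _ _ + g _ _); lia.
Qed.

(* The link relation for [e] and for [N - e], combined through hermiticity,
   forces three consecutive entries of the [e]-th diagonal to be equal. *)
Lemma offdiag_zero e : (0 < e <= K)%N ->
  (forall p, (p + e <= N)%N -> g p (p + e)%N = 0) /\
  (forall p, (p + (N - e) <= N)%N -> g p (p + (N - e))%N = 0).
Proof.
move=> /andP[e0 eK].
have link i j : (i <= K)%N -> (j <= K + 1)%N ->
    g j (i + (K + 1))%N = sg%:C%C * (g i (K + j)%N)^*.
  by move=> iK jK; rewrite -g_herm g_link// mulrA sgC2 mul1r.
pose a := g (K - e)%N K; pose b := g (K - e + 1)%N (K + 1)%N; pose c := g (K - e + 2)%N (K + 2)%N.
have l1 : g 0%N (N - e)%N = sg%:C%C * a^*.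
  have := link (K - e)%N 0%N; rewrite addn0 (_ : K - e + (K + 1) = N - e)%N; last by rewrite /N; lia.
  by apply; lia.
have l2 : g 1%N (N - e + 1)%N = sg%:C%C * b^*.
  by rewrite /b -link; [congr g; rewrite /N; lia | lia | lia].
have l3 : b = sg%:C%C * (g 0%N (N - e)%N)^*.
  rewrite (_ : N - e = K + (K + 1 - e))%N; last by rewrite /N; lia.
  by rewrite -link; [rewrite /b; congr g; lia | lia | lia].
have l4 : c = sg%:C%C * (g 1%N (N - e + 1)%N)^*.
  rewrite (_ : N - e + 1 = K + (K + 2 - e))%N; last by rewrite /N; lia.
  by rewrite -link; [rewrite /c; congr g; lia | lia | lia].
have ba : b = a by rewrite l3 l1 rmorphM /= sgC_conj conjCK mulrA sgC2 mul1r.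
have cb : c = b by rewrite l4 l2 rmorphM /= sgC_conj conjCK mulrA sgC2 mul1r.
have a0 : a = 0.
  have := @g_rec (K - e) K; rewrite -/a -/b -/c cb ba => h.
  have : - (Z%:C%C * a) = 0.
    rewrite -[RHS]h; [rewrite rmorphD /= (_ : 2%:C%C = 2) ?rmorph_nat//; ring | rewrite /N; lia..].
  move/eqP; rewrite oppr_eq0 mulf_eq0 => /orP[|/eqP//].
  by rewrite fmorph_eq0 (negPf Z0).
split.
  apply: (@diag_zero e (K - e)); first by rewrite /N; lia.
    by rewrite subnK.
  by rewrite -[RHS]a0 -ba /b; congr g; lia.
apply: (@diag_zero (N - e) 0); first by rewrite /N; lia.
  by rewrite add0n l1 a0 rmorph0 mulr0.
by rewrite add0n addnC l2 ba a0 rmorph0 mulr0.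
Qed.

Lemma dicke_rigid p q : (p <= N)%N -> (q <= N)%N ->
  g p q = g K K * (dicke_coef lam sg N p q)%:C%C.
Proof.
wlog pq : p q / (p <= q)%N.
  move=> h pN qN; case: (leqP p q) => [|/ltnW] pq; first exact: h.
  rewrite g_herm h// rmorphM /= -g_herm; congr (_ * _).
  rewrite (CrealP _); last by apply/complex_realP; eexists.
  rewrite /dicke_coef eq_sym [X in X%:C%C](_ : _ = dicke_coef lam sg N p q)// /dicke_coef.
  congr (_ + _ * _%:R); first by case: eqP => [->|_] //; rewrite !mul0r.
  by rewrite orbC ![_ && (_ == 0)%N]andbC.
move=> pN qN.
have gK0 : g 0%N N = sg%:C%C * g K K.
  have := g_link (leqnn K) (leq0n (K + 1)); rewrite addn0 => ->.
  by rewrite mulrA sgC2 mul1r; congr g; rewrite /N; lia.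
have gK1 : g (K + 1)%N (K + 1)%N = g K K.
  have := g_link (leq0n K) (leqnn (K + 1)); rewrite add0n.
  rewrite (_ : K + (K + 1) = N)%N; last by rewrite /N; lia.
  rewrite g_herm gK0 rmorphM /= sgC_conj -g_herm => /(congr1 (fun x => sg%:C%C * x)).
  by rewrite !mulrA sgC2 !mul1r.
have [e0|e0] := posnP (q - p).
  have -> : q = p by lia.
  rewrite dicke_coef_diag; last by rewrite /N; lia.
  apply/eqP; rewrite -subr_eq0; apply/eqP.
  apply: (@rec2_zero _ (fun p => g p p - g K K * (lam p)%:C%C) (2 + Z)%:C%C N K) => //.
  - move=> r rN; have := g_rec rN rN; have := lam_rec r.
    move=> /(congr1 (fun x => g K K * x%:C%C)); rewrite rmorph0 mulr0.
    rewrite rmorphD rmorphB rmorphM /= => e1 e2.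
    by rewrite -[RHS](subrr 0) -{1}e2 -e1; ring.
  - by rewrite /N; lia.
  - by rewrite lamK mulr1 subrr.
  - by rewrite lamK1 mulr1 gK1 subrr.
have [eN|eN] := eqVneq (q - p)%N N.
  have -> : p = 0%N by lia.
  have -> : q = N by lia.
  rewrite gK0 /dicke_coef (_ : _ == _ = false); last by rewrite /N; lia.
  by rewrite !eqxx /= mul0r add0r mulr1 mulrC.
rewrite /dicke_coef (_ : _ == _ = false); last by lia.
rewrite (_ : _ && _ || _ = false); last by lia.
rewrite mul0r mulr0 addr0 rmorph0 mulr0.
have qE : q = (p + (q - p))%N by lia.
case: (leqP (q - p) K) => le.
  by rewrite qE; apply: (offdiag_zero _).1; lia.
have eK : (0 < N - (q - p) <= K)%N by move: le eN; rewrite /N; lia.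
by have := (offdiag_zero eK).2 p; rewrite subKn ?subnKC//; [apply; lia | lia].
Qed.

End Rigidity.

Lemma sum_pow_card (R : realType) N (r : R) : \sum_(x : {set 'I_N}) r ^+ #|x| = (r + 1) ^+ N.
Proof.
rewrite -[N in RHS]card_ord -prodr_const bigA_distr; apply: eq_bigr => x _.
by rewrite -big_mkcond prodr_const.
Qed.

Lemma pt_coef0 (R : realType) (lam : nat -> R) sg N (x y : {set 'I_N}) :
  pt_coef lam sg set0 x y = dicke_coef lam sg N #|x| #|y|.
Proof. by rewrite /pt_coef !setI0 !setD0 cards0 !add0n. Qed.

Lemma ptrans_pt_mx (R : realType) (lam : nat -> R) sg N (S : {set 'I_N}) c :
  ptrans S (map_mx (real_complex R) (c *: pt_mx lam sg set0)) =
  map_mx (real_complex R) (c *: pt_mx lam sg S).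
Proof.
by apply/matrixP => i j; rewrite ptransE !mxE pt_coef0 !of_setK !card_ptrans.
Qed.

Section Face.
Variables (R : realType) (K : nat) (lam : nat -> R) (Z sg c : R).
Local Notation C := R[i]%C.
Let N := (2 * K + 1)%N.
Hypotheses (K1 : (1 < K)%N) (Z0 : Z != 0) (c0 : c != 0) (sg2 : sg * sg = 1).
Hypotheses (lamK : lam K = 1) (lamK1 : lam (K + 1)%N = 1).
Hypothesis lam_rec : forall k, lam k - (2 + Z) * lam (k + 1)%N + lam (k + 2)%N = 0.

Let rho : 'M[C]_(2 ^ N) := map_mx (real_complex R) (c *: pt_mx lam sg set0).

Lemma ppt_face_ray X Y : (forall S, psd (ptrans S X)) -> (forall S, psd (ptrans S Y)) ->
  X + Y = rho -> exists a, X = a *: rho.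
Proof.
move=> pX pY XY.
have K0 : (0 < K)%N by exact: ltnW.
have ptE S i j : (ptrans S X + ptrans S Y) i j =
    (c * dicke_coef lam sg N (#|ones j :&: S| + #|ones i :\: S|) (#|ones i :&: S| + #|ones j :\: S|))%:C%C.
  by rewrite -ptransD XY ptrans_pt_mx !mxE.
have hX i j : X i j = (X j i)^* by apply: psd_herm; rewrite -[X]ptrans0.
have symr i j1 j2 : #|ones j1| = #|ones j2| -> X i j1 = X i j2.
  move=> e; apply/eqP; rewrite -subr_eq0; apply/eqP.
  have h k : 1 * (ptrans set0 X + ptrans set0 Y) k j1 +
      (-1) * (ptrans set0 X + ptrans set0 Y) k j2 + 0 * (ptrans set0 X + ptrans set0 Y) k j1 = 0.
    by rewrite !ptE !setI0 !setD0 e mul1r mulN1r mul0r addr0 subrr.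
  have := psd_add_rel3 (pX set0) (pY set0) h i.
  by rewrite ptrans0 mul1r mulN1r mul0r addr0.
have sym i1 i2 j1 j2 : #|ones i1| = #|ones i2| -> #|ones j1| = #|ones j2| -> X i1 j1 = X i2 j2.
  by move=> ei ej; rewrite (symr _ _ _ ej) hX (symr _ _ _ ei) -hX.
have rep p : exists x : {set 'I_N}, (p <= N)%N -> #|x| = p.
  have [pN|] := leqP p N; last by exists set0.
  have [||x [_ xp]] := @exists_split N set0 0 p; rewrite ?cards0 ?subn0//.
  by exists x; rewrite setD0 in xp.
have [r rP] := boolp.choice rep.
pose g p q := X (of_set (r p)) (of_set (r q)).
have XE i j : X i j = g #|ones i| #|ones j|.
  by apply: sym; rewrite of_setK rP// -[N in (_ <= N)%N]card_ord max_card.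
have ptXE S i j : ptrans S X i j =
    g (#|ones j :&: S| + #|ones i :\: S|)%N (#|ones i :&: S| + #|ones j :\: S|)%N.
  by rewrite ptransE XE !of_setK !card_ptrans.
pose S := r K; have cS : #|S| = K by apply: rP; rewrite /N; lia.
have cN : (N - #|S| = K + 1)%N by rewrite cS /N; lia.
have blk i j : exists x : {set 'I_N}, (i <= K)%N -> (j <= K + 1)%N ->
    #|x :&: S| = i /\ #|x :\: S| = j.
  have [/andP[iK jK]|] := boolP ((i <= K) && (j <= K + 1))%N; last by move=> n; exists set0; lia.
  by have [||x xP] := @exists_split N S i j; [rewrite cS | rewrite cN | exists x].
have g_herm p q : g p q = (g q p)^* by exact: hX.
have g_rec p q : (p + 2 <= N)%N -> (q + 2 <= N)%N ->
    g p q - (2 + Z)%:C%C * g (p + 1)%N (q + 1)%N + g (p + 2)%N (q + 2)%N = 0.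
  move=> pN qN; pose i := minn p (K - 2); pose j' := (p - i)%N.
  pose j := minn q (K - 1); pose i' := (q - j)%N.
  have bounds : [/\ (i + 2 <= K)%N, (j + 2 <= K + 1)%N, (i' <= K)%N & (j' <= K + 1)%N].
    by move: pN qN; rewrite /N /j' /i' /i /j; split; lia.
  have [iK jK i'K j'K] := bounds.
  have pE : (p = i + j')%N by rewrite /j' /i; lia.
  have qE : (q = i' + j)%N by rewrite /i' /j; lia.
  have [x0 /(_ _ _)[||x0i x0j]] := blk i j; [lia|lia|].
  have [x1 /(_ _ _)[||x1i x1j]] := blk (i + 1)%N (j + 1)%N; [lia|lia|].
  have [x2 /(_ _ _)[||x2i x2j]] := blk (i + 2)%N (j + 2)%N; [lia|lia|].
  have [y /(_ _ _)[||yi yj]] := blk i' j'; [lia|lia|].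
  have := @psd_add_rel3 _ _ _ _ (of_set x0) (of_set x1) (of_set x2) 1 (- (2 + Z)%:C%C) 1
    (pX S) (pY S) _ (of_set y).
  rewrite !mul1r mulNr !ptXE !of_setK x0i x0j x1i x1j x2i x2j yi yj !addnA.
  rewrite !(addnAC i _ j') -qE -pE; apply=> k.
  rewrite !ptE !of_setK x0i x0j x1i x1j x2i x2j !addnA !(addnAC i _ #|_|).
  rewrite !mul1r mulNr -!rmorphM -rmorphB -rmorphD /=.
  set p' := (i + _)%N; set q' := (_ + j)%N.
  have [kS kD _ _ _] := card_split S (ones k).
  have p'N : (p' + 2 <= N)%N by move: kD; rewrite cN /p'; move: #|_| => w; rewrite /N; lia.
  have q'N : (q' + 2 <= N)%N by move: kS; rewrite cS /q'; move: #|ones k :&: S| => w; rewrite /N; lia.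
  have := dicke_coef_rec sg lam_rec p'N q'N => /(congr1 (fun t => (c * t)%:C%C)).
  by rewrite mulr0 rmorph0 => <-; congr (_%:C%C); ring.
have g_link i j : (i <= K)%N -> (j <= K + 1)%N ->
    g (K + j)%N i = sg%:C%C * g j (i + (K + 1))%N.
  move=> iK jK; have [y /(_ iK jK)[yi yj]] := blk i j.
  have cSC : #|~: S| = (K + 1)%N by have := cardsC S; rewrite card_ord; lia.
  have SI : ~: S :&: S = set0 by rewrite setIC setICr.
  have SD : ~: S :\: S = ~: S by rewrite setDE setIid.
  apply/eqP; rewrite -subr_eq0; apply/eqP.
  have := @psd_add_rel3 _ _ _ _ (of_set S) (of_set (~: S)) (of_set S) 1 (- sg%:C%C) 0
    (pX S) (pY S) _ (of_set y).
  rewrite mul1r mul0r mulNr addr0 !ptXE !of_setK setIid setDv SI SD cards0 cS cSC yi yj.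
  rewrite addn0 add0n; apply=> k; rewrite !ptE !of_setK setIid setDv SI SD cards0 cS cSC.
  rewrite mul1r mul0r mulNr addr0 addn0 add0n -rmorphM -rmorphB /=.
  have [kS kD _ _ _] := card_split S (ones k); rewrite cS in kS; rewrite cN in kD.
  by rewrite (dicke_coef_link sg2 lamK lamK1 kS kD) mulrCA subrr.
exists (g K K / c%:C%C); apply/matrixP => i j; rewrite XE.
have le (x : {set 'I_N}) : (#|x| <= N)%N by rewrite -[N in (_ <= N)%N]card_ord max_card.
rewrite (dicke_rigid lam_rec sg2 lamK lamK1 K0 Z0 g_herm g_rec g_link (le _) (le _)).
rewrite !mxE pt_coef0 rmorphM /= mulrA mulfVK//.
by rewrite fmorph_eq0.
Qed.

End Face.

(** * Product states *)

Section Product.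
Variable R : realType.
Local Notation C := R[i]%C.

Lemma psd_diag_ge0 n (A : 'M[C]_n) i : psd A -> 0 <= A i i.
Proof.
move=> [_ /(_ (delta_mx i 0))]; rewrite -mulmxA -colE mxE (bigD1 i)//= big1 ?addr0.
  by rewrite !mxE !eqxx conjC1 mul1r.
by move=> j ji; rewrite !mxE (negPf ji) conjC0 mul0r.
Qed.

Lemma psd_diag0 n (A : 'M[C]_n) i : psd A -> A i i = 0 -> forall j, A j i = 0.
Proof.
move=> pA Ai0 j; have := @psd_ker _ _ A (delta_mx i 0) pA; rewrite -mulmxA -colE.
have -> : (adjmx (delta_mx i 0 : 'cV[C]_n) *m col i A) 0 0 = 0.
  rewrite mxE (bigD1 i)//= big1 ?addr0 => [|k ki]; first by rewrite !mxE Ai0 mulr0.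
  by rewrite !mxE (negPf ki) conjC0 mul0r.
by move=> /(_ erefl) /matrixP /(_ j 0); rewrite !mxE.
Qed.

(* Cholesky decomposition without square roots; when [M 0 0 = 0] the first
   column of [M] vanishes and the junk value [0^-1 = 0] is harmless. *)
Lemma psd2_gram (M : 'M[C]_2) : psd M ->
  exists p : ('I_2 -> C) * ('I_2 -> 'I_2 -> C), (forall t, 0 <= p.1 t) /\
    forall x y, M x y = \sum_t p.1 t * (p.2 t x * (p.2 t y)^*).
Proof.
move=> pM.
pose d := M 1 1 - M 1 0 * M 0 1 / M 0 0.
exists (fun t => if t == 0 then (M 0 0)^-1 else d,
        fun t x => if t == 0 then M x 0 else (x == 1)%:R) => /=.
have M0 := psd_diag_ge0 0 pM; have M1 := psd_diag_ge0 1 pM.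
have z := psd_diag0 pM (i := 0).
split.
  move=> t; case: ifP => _; first by rewrite invr_ge0.
  have [e0|n0] := eqVneq (M 0 0) 0; first by rewrite /d e0 invr0 mulr0 subr0.
  pose v : 'cV[C]_2 := \col_i (if i == 0 then - M 0 1 else M 0 0).
  have := pM.2 v; rewrite quadE !big_ord_recl !big_ord0 !mxE /= !addr0.
  have -> : lift ord0 ord0 = 1 :> 'I_2 by apply/val_inj.
  rewrite rmorphN /= -(psd_herm 1 0 pM) -(psd_herm 0 0 pM).
  rewrite (_ : _ + _ = M 0 0 ^+ 2 * d); first by rewrite pmulr_rge0// exprn_gt0// lt_def n0.
  by rewrite /d; field.
move=> x y; rewrite !big_ord_recl big_ord0 /= addr0 -(psd_herm 0 y pM).
have yx : forall x : 'I_2, x = 0 \/ x = 1.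
  by case=> [[|[|//]] lt]; [left|right]; apply/val_inj.
have oi : (0 == 1 :> 'I_2) = false by [].
have [e0|n0] := eqVneq (M 0 0) 0.
  have {}z := z e0; rewrite /d e0 invr0 mulr0 subr0 mul0r add0r.
  have z' j : M 0 j = 0 by rewrite (psd_herm 0 j pM) z conjC0.
  have [->|->] := yx x; first by rewrite z' oi !mul0r mulr0.
  have [->|->] := yx y; first by rewrite z oi conjC0 !mulr0.
  by rewrite eqxx conjC1 !mulr1.
rewrite /d; have [->|->] := yx x; have [->|->] := yx y.
- by rewrite oi mul0r mulr0 addr0 mulrA mulVf// mul1r.
- by rewrite oi mul0r mulr0 addr0 mulrA mulVf// mul1r.
- by rewrite oi conjC0 !mulr0 addr0 mulrCA mulVf// mulr1.
- by rewrite eqxx conjC1 !mulr1; move: (M 0 0) (M 1 0) (M 0 1) (M 1 1) n0 => a b c d' n0; field.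
Qed.

Lemma prod_op_psd N (M : 'I_N -> 'M[C]_2) : (forall k, psd (M k)) -> psd (prod_op M).
Proof.
move=> pM; have [p pP] := fin_all_exists (fun k => psd2_gram (pM k)).
apply: (@psd_gram _ _ {ffun 'I_N -> 'I_2} (fun f => \prod_k (p k).1 (f k))
  (fun f i => \prod_k (p k).2 (f k) (qbit2 i k))).
  by move=> f; apply: prodr_ge0 => k _; exact: (pP k).1.
move=> i j; rewrite mxE; under eq_bigr do rewrite (pP _).2.
rewrite bigA_distr_bigA; apply: eq_bigr => f _.
by rewrite rmorph_prod -!big_split.
Qed.

Lemma prod_opE N (M : 'I_N -> 'M[C]_2) x y : prod_op M (of_set x) (of_set y) =
  \prod_k M k (inord (k \in x)) (inord (k \in y)).
Proof. by rewrite mxE; apply: eq_bigr => k _; rewrite /qbit2 !of_bitsK. Qed.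

Lemma ptrans_prod_op N (S : {set 'I_N}) (M : 'I_N -> 'M[C]_2) :
  ptrans S (prod_op M) = prod_op (fun k => if k \in S then (M k)^T else M k).
Proof.
apply/matrixP => i j; rewrite ptransE prod_opE -(onesK i) -(onesK j) prod_opE !onesK.
apply: eq_bigr => k _; rewrite !inE.
by case: (k \in S); rewrite ?mxE ?andbT ?andbF ?orbF ?orFb.
Qed.

Lemma psd_tr n (A : 'M[C]_n) : psd A -> psd A^T.
Proof.
move=> [hA pA]; split=> [|v]; first by rewrite -[in RHS]hA; apply/matrixP => i j; rewrite !mxE.
have := pA (\col_i (v i 0)^*); rewrite !quadE exchange_big => h.
rewrite (le_trans h)// le_eqVlt; apply/orP; left; apply/eqP.
apply: eq_bigr => i _; apply: eq_bigr => j _; rewrite !mxE conjCK; ring.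
Qed.

Lemma ptrans_prod_op_psd N (S : {set 'I_N}) (M : 'I_N -> 'M[C]_2) :
  (forall k, psd (M k)) -> psd (ptrans S (prod_op M)).
Proof.
move=> pM; rewrite ptrans_prod_op; apply: prod_op_psd => k.
by case: ifP => _ //; apply: psd_tr.
Qed.

End Product.

Lemma ketbra_dicke (R : realType) N k l (i j : 'I_(2 ^ N)) :
  ketbra (dicke R N k) (dicke R N l) i j =
  ((#|ones i| == k)%:R * (#|ones j| == l)%:R /
    (Num.sqrt 'C(N, k)%:R * Num.sqrt 'C(N, l)%:R))%:C%C.
Proof.
rewrite mxE big_ord1 !mxE !hweightE.
case: eqP => _; last by rewrite !mul0r rmorph0.
case: eqP => _; last by rewrite conjC0 /= !mulr0 mul0r rmorph0.
rewrite (CrealP _); last by apply/complex_realP; eexists.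
by rewrite -rmorphM -invfM /= !mul1r.
Qed.

Lemma dicke_mixE (R : realType) N (lam : nat -> R) sg : (0 < N)%N ->
  \sum_(k < N.+1) (('C(N, k)%:R * lam k)%:C)%C *: ketbra (dicke R N k) (dicke R N k) +
  (sg%:C)%C *: (ketbra (dicke R N 0) (dicke R N N) + ketbra (dicke R N N) (dicke R N 0)) =
  map_mx (real_complex R) (pt_mx lam sg set0).
Proof.
move=> N0; apply/matrixP => i j; rewrite [LHS]mxE [RHS]mxE [in RHS]mxE pt_coef0 /dicke_coef rmorphD /=; congr (_ + _).
  have le : (#|ones i| < N.+1)%N by rewrite ltnS -[N in (_ <= N)%N]card_ord max_card.
  rewrite summxE (bigD1 (Ordinal le))//= big1 ?addr0 => [|k]; last first.
    rewrite -val_eqE /= eq_sym => /negPf ne.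
    by rewrite mxE ketbra_dicke ne /= !mul0r rmorph0 mulr0.
  rewrite mxE ketbra_dicke eqxx [#|ones j| == _]eq_sym -rmorphM; congr (_%:C%C).
  rewrite -expr2 sqr_sqrtr ?ler0n//.
  have C0 : 'C(N, #|ones i|)%:R != 0 :> R by rewrite pnatr_eq0 -lt0n bin_gt0 -ltnS.
  by rewrite mul1r; field.
rewrite [LHS]mxE [in LHS]mxE !ketbra_dicke bin0 binn sqrtr1 !mulr1 !divr1 -rmorphD -rmorphM.
congr ((_ * _)%:C%C). 
rewrite -!natrM -natrD; congr (_%:R); case: eqP => [->|_].
  by rewrite (ltn_eqF N0) mul1n mul0n addn0 andTb andFb orbF.
by rewrite mul0n add0n mulnb.
Qed.

Lemma sum_lam (R : realType) (K : nat) (lam : nat -> R) (Z s u : R) : 0 < s -> 0 < u ->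
  s * u = 1 -> (s + u) ^+ 2 = 4 + Z -> (forall k, (k <= 2 * K + 1)%N ->
    lam k = u ^+ (2 * K + 1) / (s + u) * s ^+ (2 * k)
          + s ^+ (2 * K + 1) / (s + u) * u ^+ (2 * k)) ->
  \sum_(x : {set 'I_(2 * K + 1)}) lam #|x| = 2 * (4 + Z) ^+ K.
Proof.
move=> s0 u0 su spu lamE.
have spu0 : s + u != 0 by rewrite gt_eqF// addr_gt0.
transitivity (\sum_(x : {set 'I_(2 * K + 1)}) (u ^+ (2 * K + 1) / (s + u) * (s ^+ 2) ^+ #|x|
          + s ^+ (2 * K + 1) / (s + u) * (u ^+ 2) ^+ #|x|)).
  apply: eq_bigr => x _; rewrite lamE ?exprM//.
  by rewrite -[X in (_ <= X)%N]card_ord max_card.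
rewrite big_split /= -!mulr_sumr !sum_pow_card ![_ / _ * _]mulrAC -!exprMn.
rewrite (_ : u * (s ^+ 2 + 1) = s + u); last by rewrite mulrDr expr2 mulrA [u * s]mulrC su; ring.
rewrite (_ : s * (u ^+ 2 + 1) = s + u); last by rewrite mulrDr expr2 mulrA su; ring.
by rewrite exprD expr1 exprM spu; field.
Qed.

Local Open Scope complex_scope.

Theorem theorem7 (R : realType) (K N : nat) (Z sigma : R) (f : int -> R) :
  (1 < K)%N -> N = (2 * K + 1)%N -> 0 < Z -> (sigma = 1 \/ sigma = -1) ->
  f 0 = 1 -> f 1 = 1 + Z ->
  (forall k : int, f (k + 2) = (2 + Z) * f (k + 1) - f k) ->
  let lambda (k : nat) : R := f (K%:Z - k%:Z) in
  let d : 'M[R[i]]_(2 ^ N) :=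
    \sum_(k < N.+1)
       (('C(N, k)%:R * lambda k)%:C) *: ketbra (dicke R N k) (dicke R N k) in
  let o : 'M[R[i]]_(2 ^ N) :=
    (sigma%:C) *: (ketbra (dicke R N 0) (dicke R N N)
                   + ketbra (dicke R N N) (dicke R N 0)) in
  let rho : 'M[R[i]]_(2 ^ N) := ((2 * (4 + Z) ^+ K)^-1)%:C *: (d + o) in
  ppt_all rho /\
      \rank rho = N.+1 /\
      (forall S : {set 'I_N}, (1 <= #|S| < K)%N -> \rank (ptrans S rho) = (2 * N)%N) /\
      (forall S : {set 'I_N}, #|S| = K -> \rank (ptrans S rho) = (2 * N - 1)%N) /\
      extreme_point (@ppt_all R N) rho /\
      ~ fully_separable rho.
Proof.
move=> K1 NE Z0 sgE f0 f1 frec lambda d o rho; subst N.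
have sg2 : sigma * sigma = 1 by case: sgE => ->; ring.
have N0 : (0 < 2 * K + 1)%N by lia.
have N1 : (1 < 2 * K + 1)%N by lia.
pose c := (2 * (4 + Z) ^+ K)^-1.
have S0 : 0 < 2 * (4 + Z) ^+ K by rewrite mulr_gt0// exprn_gt0//; lra.
have c0 : 0 < c by rewrite invr_gt0.
have cn0 : c != 0 by rewrite gt_eqF.
have rhoE : rho = map_mx (real_complex R) (c *: pt_mx lambda sigma set0).
  by rewrite /rho /d /o dicke_mixE// map_mxZ.
have ptE S : ptrans S rho = map_mx (real_complex R) (c *: pt_mx lambda sigma S).
  by rewrite rhoE ptrans_pt_mx.
have lamK' : lambda K = 1 by apply: lamK.
have lamK1' : lambda (K + 1)%N = 1 by apply: lamK1 f0 f1 frec.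
have lamrec : forall k, lambda k - (2 + Z) * lambda (k + 1)%N + lambda (k + 2)%N = 0.
  exact: lam_rec.
have lam1 k : (k <= 2 * K + 1)%N -> 1 <= lambda k by apply: lam_ge1 f0 f1 frec Z0 _.
have lamgt k : (k < K)%N -> 1 < lambda k by apply: lam_gt1 f0 f1 frec Z0 _.
have lamsym k : (k <= 2 * K + 1)%N -> lambda (2 * K + 1 - k)%N = lambda k.
  by apply: lam_sym f0 f1 frec _.
have [s [u [s0 u0 sNu su [spu lamE]]]] := lam_exp K f0 f1 frec Z0.
have psd_rho S : psd (ptrans S rho) by rewrite ptE; apply: (pt_mx_psd N0 lamsym sg2 lamE s0 u0) => //; exact: ltW.
have tr_rho : \tr rho = 1.
  rewrite rhoE /mxtrace; under eq_bigr do rewrite mxE mxE mxE pt_coef0.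
  rewrite -rmorph_sum -mulr_sumr /= (big_ones (fun x => dicke_coef lambda sigma (2 * K + 1) #|x| #|x|)).
  rewrite -[RHS](rmorph1 (real_complex R)) -(mulVf (lt0r_neq0 S0)).
  congr (_%:C); congr (_ * _); rewrite -(sum_lam s0 u0 su spu lamE).
  by apply: eq_bigr => x _; rewrite dicke_coef_diag.
have state_rho : is_state rho by split=> //; rewrite -[rho](ptrans0); exact: psd_rho.
have ppt_rho : ppt_all rho by split.
have ray X Y : (forall S, psd (ptrans S X)) -> (forall S, psd (ptrans S Y)) ->
    X + Y = rho -> exists a, X = a *: rho.
  rewrite rhoE; apply: (ppt_face_ray K1 (lt0r_neq0 Z0) cn0 sg2 lamK' lamK1' lamrec).
have rank_scale S : \rank (ptrans S rho) = \rank (pt_mx lambda sigma S).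
  by rewrite ptE mxrank_map mxrank_scale_nz.
split=> //; split.
  rewrite -[rho](ptrans0) rank_scale; apply: (dicke_rank N0 lamsym sg2 lam1); apply: lamgt; lia.
split.
  move=> S /andP[S1 SK]; rewrite rank_scale.
  rewrite (pt_mx_rank N0 lamsym sg2 lamE s0 u0 sNu (P := predT)).
  - by rewrite card_sum card_prod card_bool card_ord; lia.
  - by rewrite S1 (leq_trans SK)//; lia.
  - have := lamgt _ SK => l1; case=> [p|b]; first by rewrite gt_eqF// pt_weightl_gt0.
    by rewrite gt_eqF//; case: b; rewrite /= ?expr1 ?expr0; lra.
split.
  move=> S SK; rewrite rank_scale.
  rewrite (pt_mx_rank N0 lamsym sg2 lamE s0 u0 sNu (P := predC1 (inr true))).
  - by rewrite cardC1 card_sum card_prod card_bool card_ord; lia.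
  - by rewrite SK; lia.
  - case=> [p|b]; first by rewrite [in RHS]gt_eqF// pt_weightl_gt0.
    rewrite /= SK lamK'; case: b; rewrite /= ?expr1 ?expr0 ?subrr ?mul0r ?eqxx//.
    by rewrite [in RHS]gt_eqF//; lra.
split.
  split=> // A1 A2 t [[pA1 tr1] ptA1] [[pA2 tr2] ptA2] /andP[t0 t1] e.
  have face (r : R) A A' r' : 0 < r -> 0 < r' -> \tr A = 1 -> (forall S, psd (ptrans S A)) ->
      (forall S, psd (ptrans S A')) -> rho = r%:C *: A + r'%:C *: A' -> A = rho.
    move=> r0 r'0 trA pA pA' re.
    have [| |a ra] := @ray (r%:C *: A) (r'%:C *: A') _ _ (esym re).
    - by move=> S; rewrite ptransZ; apply: psdZ => //; rewrite lecR ltW.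
    - by move=> S; rewrite ptransZ; apply: psdZ => //; rewrite lecR ltW.
    have ar : r%:C = a by have := congr1 mxtrace ra; rewrite [LHS]mxtraceZ [RHS]mxtraceZ trA tr_rho !mulr1.
    move: ra; rewrite -ar => /scalerI; apply.
    by rewrite fmorph_eq0 gt_eqF.
  have t1' : 0 < 1 - t by rewrite subr_gt0.
  split; first exact: (face t A1 A2 (1 - t)).
  by apply: (face (1 - t) A2 A1 t) => //; rewrite addrC.
move=> [m [p [M [p0 _ pM rhoS]]]].
have entry x y : rho (of_set x) (of_set y) = (c * dicke_coef lambda sigma (2 * K + 1) #|x| #|y|)%:C.
  by rewrite rhoE !mxE !of_setK pt_coef0.
have cardT : #|[set: 'I_(2 * K + 1)]| = (2 * K + 1)%N by rewrite cardsT card_ord.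
have [l Xl] : exists l, (p l)%:C * prod_op (M l) (of_set set0) (of_set setT) != 0.
  apply/existsP; apply/contraT; rewrite negb_exists => /forallP h.
  have := entry set0 setT; rewrite rhoS summxE big1 => [/esym/eqP|l _].
    rewrite fmorph_eq0 mulf_eq0 (negPf cn0) /= cards0 cardT /dicke_coef eqxx.
    rewrite (ltn_eqF N0) mul0r add0r eqxx /= mulr1 => /eqP sg0.
    by move: sg2; rewrite sg0 mul0r => /esym/eqP; rewrite oner_eq0.
  by rewrite [LHS]mxE; have := h l; rewrite negbK => /eqP.
pose X := (p l)%:C *: prod_op (M l).
have psdP k S : psd (ptrans S ((p k)%:C *: prod_op (M k))).
  rewrite ptransZ; apply: psdZ; first by rewrite lecR.
  by apply: ptrans_prod_op_psd => q; have [] := pM k q.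
have [|||a Xa] := @ray X (\sum_(k | k != l) (p k)%:C *: prod_op (M k)).
- by move=> S; exact: psdP.
- by move=> S; rewrite ptrans_sum; apply: psd_sum => k _; exact: psdP.
- by rewrite rhoS [RHS](bigD1 l).
have XE (x y : {set 'I_(2 * K + 1)}) : (p l)%:C * \prod_k M l k (inord (k \in x)) (inord (k \in y)) =
    a * (c * dicke_coef lambda sigma (2 * K + 1) #|x| #|y|)%:C.
  by rewrite -entry -prod_opE; have := congr1 (fun A : 'M_(_) => A (of_set x) (of_set y)) Xa; rewrite !mxE.
have a0 : a != 0.
  by apply: contraNneq Xl => az; rewrite prod_opE XE az mul0r.
have [pl M01] : (p l)%:C != 0 /\ forall k, M l k (inord 0) (inord 1) != 0.
  move: Xl; rewrite prod_opE mulf_eq0 negb_or => /andP[-> /prodf_neq0 h]; split=> // k.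
  by have := h k isT; rewrite inE in_setT.
have M00 k : M l k (inord 0) (inord 0) != 0.
  have : (p l)%:C * \prod_k M l k (inord (k \in set0)) (inord (k \in set0)) != 0.
    rewrite XE mulf_neq0// fmorph_eq0 mulf_neq0// cards0 dicke_coef_diag//.
    exact: lt0r_neq0 (lt_trans ltr01 (lamgt 0%N (ltnW K1))).
  by rewrite mulf_eq0 negb_or => /andP[_ /prodf_neq0 /(_ k isT)]; rewrite inE.
pose k0 : 'I_(2 * K + 1) := Ordinal N0.
have d01 : dicke_coef lambda sigma (2 * K + 1) #|@set0 'I_(2 * K + 1)| #|[set k0]| = 0.
  by rewrite cards0 cards1; exact: dicke_coef01 N0 N1.
have /eqP := XE set0 [set k0].
rewrite d01 mulr0 rmorph0 mulr0 mulf_eq0 (negPf pl) /=.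
apply/negP/prodf_neq0 => k _; rewrite inE; case: (k \in _).
  exact: M01.
exact: M00.
Qed.
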